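(* Let $(\Omega,P,\pi)$ be a finite ergodic Markov chain, let $S,T\subseteq\Omega$ with $\pi(S),\pi(T)>0$, and let $\Gamma$ be a transport flow from $S$ to $T$. Suppose that for all $x,y\in\Omega$ with $P(x,y)>0$, \[\phi_{xy}:=\frac{\pi(S)\pi(T)}{\pi(x)P(x,y)}\,\mathbb E_{\gamma\sim\Gamma}\bigl[\mathbf 1[(x,y)\in\gamma]\bigr]\le\rho,\] and define the average congestion \[\bar\rho=\sum_{x,y\in\Omega}\phi_{xy}\pi(x)P(x,y)=\pi(S)\pi(T)\sum_{x,y\in\Omega}\mathbb E_{\gamma\sim\Gamma}\mathbf 1[(x,y)\in\gamma].\] Then for every $f:\Omega\to\mathbb R$, \[\pi(S)\pi(T)\bigl(F(S)-F(T)\bigr)^2\le\frac{\bar\rho\,\rho}{\pi(S)\pi(T)}\sum_{x,y\in\Omega}\pi(x)P(x,y)(f(x)-f(y))^2,\] where $F(A)=\mathbb E_{x\sim\pi_A}f(x)$.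
   Context: For $A\subseteq\Omega$ with $\pi(A)>0$, $\pi_A(x)=\pi(x)/\pi(A)$ for $x\in A$ (and $0$ otherwise). A path is a finite sequence $(x_0,\dots,x_m)$ of states with $P(x_k,x_{k+1})>0$; $(x,y)\in\gamma$ means $(x,y)=(x_k,x_{k+1})$ for some $k$. A transport flow from $S$ to $T$ is a probability distribution $\Gamma$ on paths such that, for $\gamma\sim\Gamma$, the starting state of $\gamma$ is distributed as $\pi_S$ and the ending state as $\pi_T$. *)

(* Defs.v *)
From HB Require Import structures.
From mathcomp Require Import all_boot all_order all_algebra.
From mathcomp Require Import all_classical all_reals all_analysis.

Set Implicit Arguments.
Unset Strict Implicit.
Unset Printing Implicit Defensive.

Import Order.TTheory GRing.Theory Num.Theory.

Local Open Scope classical_set_scope.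
Local Open Scope ring_scope.

Section FiniteMarkovChain.
Context {R : realType} {Omega : finType}.
Implicit Types (P : Omega -> Omega -> R) (pi : Omega -> R).
Implicit Types (A : {set Omega}) (f : Omega -> R).

Definition distribution_on pi :=
  (forall x, 0 <= pi x) /\ \sum_x pi x = 1.

Definition stochastic P := forall x, distribution_on (P x).

Definition stationary P pi := forall y, \sum_x pi x * P x y = pi y.

Fixpoint nstep P (n : nat) (x y : Omega) : R :=
  if n is m.+1 then \sum_z P x z * nstep P m z y else (x == y)%:R.

Definition irreducible P := forall x y, exists n, 0 < nstep P n x y.

(* The gcd of the (possibly infinite) set of return times to x is 1: its only
   common divisor is 1. *)
Definition aperiodic P := forall x (d : nat),
  (forall n, (0 < n)%N -> 0 < nstep P n x x -> (d %| n)%N) -> d = 1%N.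

Definition mass pi A : R := \sum_(x in A) pi x.

Definition cond_dist pi A (x : Omega) : R :=
  if x \in A then pi x / mass pi A else 0.

Definition cond_mean pi f A : R := \sum_x cond_dist pi A x * f x.

End FiniteMarkovChain.

Record ergodic_chain (R : realType) (Omega : finType) := ErgodicChain {
  trans : Omega -> Omega -> R ;
  stat : Omega -> R ;
  trans_stochastic : stochastic trans ;
  stat_distribution : distribution_on stat ;
  stat_stationary : stationary trans stat ;
  trans_irreducible : irreducible trans ;
  trans_aperiodic : aperiodic trans
}.

(* (x_0, [:: x_1; ...; x_m]), with m = 0 allowed. *)
Definition chain_path (R : realType) (Omega : finType)
    (M : ergodic_chain R Omega) : Type :=
  {g : Omega * seq Omega | path (fun x y => 0 < trans M x y) g.1 g.2}.

Section ChainPath.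
Context {R : realType} {Omega : finType} (M : ergodic_chain R Omega).
Local Notation P := (trans M).
Local Notation pi := (stat M).
Implicit Types (S T : {set Omega}) (g : chain_path M) (x y : Omega).

Lemma ergodic_chain_inhabited : exists x : Omega, predT x.
Proof.
have [_ sum1] := stat_distribution M.
case: (pickP (@predT Omega)) => [x _|no]; first by exists x.
by move: sum1; rewrite big_pred0// => /eqP; rewrite eq_sym oner_eq0.
Qed.

HB.instance Definition _ := Countable.on (chain_path M).

HB.instance Definition _ := isPointed.Build (chain_path M)
  (exist (fun g : Omega * seq Omega => path (fun x y => 0 < P x y) g.1 g.2)
    (xchoose ergodic_chain_inhabited, [::]) isT).

(* Every set of paths is measurable, there being only countably many paths. *)
HB.instance Definition _ := @isMeasurable.Build default_measure_display
  (chain_path M) discrete_measurable discrete_measurable0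
  discrete_measurableC discrete_measurableU.

Implicit Types Gamma : probability (chain_path M) R.

Definition path_start g : Omega := (val g).1.

Definition path_end g : Omega := last (val g).1 (val g).2.

(* zip truncates to the shorter list, which gives the pairs (x_k, x_{k+1})
   for k < m. *)
Definition path_edges g : seq (Omega * Omega) :=
  zip ((val g).1 :: (val g).2) (val g).2.

Definition transport_flow S T Gamma : Prop :=
  (forall x, Gamma [set g | path_start g = x] = (cond_dist pi S x)%:E) /\
  (forall x, Gamma [set g | path_end g = x] = (cond_dist pi T x)%:E).

Definition edge_prob Gamma x y : R :=
  fine ('E_Gamma[\1_[set g | (x, y) \in path_edges g]])%E.

(* Meaningful where P x y > 0; equal to 0 where P x y = 0, as z / 0 = 0. *)
Definition congestion S T Gamma x y : R :=
  mass pi S * mass pi T / (pi x * P x y) * edge_prob Gamma x y.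

Definition avg_congestion S T Gamma : R :=
  \sum_x \sum_y congestion S T Gamma x y * (pi x * P x y).

End ChainPath.

(* Main.v *)
(* Let q(x,y) be the probability that the random path uses the edge (x,y).
   Coupling the end points by the flow, F(S) - F(T) is the expectation of
   f(start) - f(end), hence is bounded by sum q(x,y) |f(x) - f(y)|.  By the
   weighted Cauchy-Schwarz inequality its square is at most
   (sum q) (sum q(x,y) (f(x) - f(y))^2); the first factor is the average
   congestion divided by pi(S) pi(T), and in the second one
   pi(S) pi(T) q(x,y) <= rho pi(x) P(x,y). *)

Require Import Defs.
From mathcomp Require Import all_boot all_order all_algebra.
From mathcomp Require Import all_classical all_reals all_analysis.
From mathcomp Require Import ring lra.

Set Implicit Arguments.
Unset Strict Implicit.
Unset Printing Implicit Defensive.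

Import Order.TTheory GRing.Theory Num.Theory.

Local Open Scope ring_scope.

(** Lagrange's identity: twice the right side minus the left is the sum over pairs of
    [w i * w j * (d i - d j) ^+ 2]. *)
Lemma sqr_weighted_sum_le (R : realFieldType) (I : finType) (w d : I -> R) :
  (forall i, 0 <= w i) ->
  (\sum_i w i * d i) ^+ 2 <= (\sum_i w i) * \sum_i w i * d i ^+ 2.
Proof.
move=> w0.
have H : 0 <= \sum_i \sum_j w i * w j * (d i - d j) ^+ 2.
  by apply: sumr_ge0 => i _; apply: sumr_ge0 => j _;
    rewrite mulr_ge0 ?sqr_ge0// mulr_ge0.
suff E : \sum_i \sum_j w i * w j * (d i - d j) ^+ 2 =
    2 * ((\sum_i w i) * (\sum_i w i * d i ^+ 2) - (\sum_i w i * d i) ^+ 2).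
  by move: H; rewrite E pmulr_rge0// subr_ge0.
transitivity (\sum_i (w i * d i ^+ 2 * (\sum_j w j)
    + w i * (\sum_j w j * d j ^+ 2) - 2 * (w i * d i) * \sum_j w j * d j)).
  apply: eq_bigr => i _; rewrite !mulr_sumr -sumrN -!big_split /=.
  by apply: eq_bigr => j _; ring.
rewrite !big_split sumrN -!mulr_suml -mulr_sumr /=; ring.
Qed.

Lemma path_zipE (A : Type) (e : A -> A -> bool) (x : A) (p : seq A) :
  path e x p = all (fun a => e a.1 a.2) (zip (x :: p) p).
Proof. by elim: p x => //= y p IHp x; rewrite IHp. Qed.

Lemma dist_last_le_sum_edges (R : numDomainType) (A : Type) (f : A -> R)
    (x : A) (p : seq A) :
  `|f x - f (last x p)| <= \sum_(e <- zip (x :: p) p) `|f e.1 - f e.2|.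
Proof.
elim: p x => [|y p IHp] x /=; first by rewrite big_nil subrr normr0.
by rewrite big_cons (le_trans (ler_distD (f y) _ _))// lerD2l.
Qed.

(* A path may repeat an edge, but deleting its loops leaves a path between the
   same end points, whose edges are distinct. *)
Lemma dist_last_le_sum_edge_set (R : numDomainType) (A : finType) (f : A -> R)
    (x : A) (p : seq A) :
  `|f x - f (last x p)| <=
    \sum_(e : A * A) (e \in zip (x :: p) p)%:R * `|f e.1 - f e.2|.
Proof.
(* Taking the path's own edges as the relation ensures that the loop-erased path [q] uses only edges
   of [p]. *)
have : path (fun a b => (a, b) \in zip (x :: p) p) x p.
  by rewrite path_zipE; apply/allP => -[a b].
set E := zip (x :: p) p => /shortenP[q pathq uniqq _].
apply: (le_trans (dist_last_le_sum_edges f x q)).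
rewrite (big_uniq _ (zip_uniql _ uniqq)) big_mkcond; apply: ler_sum => e _ /=.
case: ifP => [eq|_]; last by rewrite mulr_ge0.
have : e \in E.
  by case: e eq => a b; move: pathq; rewrite path_zipE => /allP; apply.
by move=> ->; rewrite mul1r.
Qed.

(** Reduces expectations over the infinite path space to finite sums; finiteness of [mu] makes the
    indicators integrable and lets [fine] pass through the sum. *)
Lemma Rintegral_sum_indic (d : measure_display) (X : measurableType d)
    (R : realType) (mu : {finite_measure set X -> \bar R}) (I : finType)
    (c : I -> R) (A : I -> set X) :
  (forall i, measurable (A i)) ->
  \int[mu]_t (\sum_i c i * \1_(A i) t) = \sum_i c i * fine (mu (A i)).
Proof.
move=> mA; rewrite /Rintegral.
under eq_integral do rewrite -sumEFin.
have int1 i : mu.-integrable setT (fun t => (\1_(A i) t)%:E).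
  exact: integrable_indic.
rewrite integral_sum//; last first.
  by move=> i; under eq_fun do rewrite EFinM; exact: integrableZl.
rewrite -sum_fine => [|i _]; last first.
  under eq_integral do rewrite EFinM.
  by rewrite integralZl// fin_numM ?integral_indic ?setIT// fin_num_measure.
apply: eq_bigr => i _; under eq_integral do rewrite EFinM.
by rewrite integralZl// fineM ?integral_indic ?setIT// fin_num_measure.
Qed.

Section ErgodicChain.
Local Open Scope classical_set_scope.
Local Open Scope ring_scope.
Context {R : realType} {Omega : finType} (M : ergodic_chain R Omega).
Local Notation P := (trans M).
Local Notation pi := (stat M).
Implicit Types (S T : {set Omega}) (Gamma : probability (chain_path M) R).

Lemma nstep_ge0 n x y : 0 <= nstep P n x y.
Proof.
elim: n x => [|n IHn] x /=; first by [].
by apply: sumr_ge0 => z _; rewrite mulr_ge0 ?IHn//;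
  case: (trans_stochastic M x).
Qed.

Lemma stat_nstep n y : \sum_x pi x * nstep P n x y = pi y.
Proof.
elim: n => [|n IHn] /=.
  rewrite (bigD1 y)//= eqxx mulr1 big1 ?addr0// => x /negbTE ->.
  by rewrite mulr0.
under eq_bigr do rewrite mulr_sumr.
rewrite exchange_big -[RHS]IHn; apply: eq_bigr => z _ /=.
rewrite -(stat_stationary M z) mulr_suml.
by apply: eq_bigr => x _; rewrite mulrA.
Qed.

(** Some [x] has positive mass, irreducibility leads from [x] to [y] in [n] steps, and [n]-step
    stationarity carries mass along. *)
Lemma stat_gt0 y : 0 < pi y.
Proof.
have [pi0 pi1] := stat_distribution M.
have [x pix] : exists x, 0 < pi x.
  apply: contrapT => npi; have : \sum_x pi x = 0.
    apply: big1 => x _; apply/eqP; rewrite eq_le pi0 andbT leNgt.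
    by apply/negP => pix; apply: npi; exists x.
  by move/eqP; rewrite pi1 oner_eq0.
have [n xy] := trans_irreducible M x y.
rewrite -(stat_nstep n) (bigD1 x)//= ltr_wpDr ?mulr_gt0//.
by apply: sumr_ge0 => z _; rewrite mulr_ge0 ?nstep_ge0.
Qed.

Lemma edge_probE Gamma x y :
  edge_prob Gamma x y = fine (Gamma [set g | (x, y) \in path_edges g]).
Proof. by rewrite /edge_prob expectation_indic. Qed.

Lemma edge_prob_ge0 Gamma x y : 0 <= edge_prob Gamma x y.
Proof. by rewrite edge_probE fine_ge0. Qed.

Lemma edge_prob_eq0 Gamma x y : ~~ (0 < P x y) -> edge_prob Gamma x y = 0.
Proof.
move=> Pxy; rewrite edge_probE (_ : [set g | _] = set0) ?measure0//.
apply/seteqP; split=> // g /= xyg; case/negP: Pxy; move: (valP g).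
by rewrite path_zipE => /allP/(_ _ xyg).
Qed.

(** Where [P x y] is positive the denominator cancels, as [pi x] is positive too. Elsewhere no path
    uses the edge, so both sides vanish and sums may run over all pairs. *)
Lemma congestion_mul_flow S T Gamma x y :
  congestion S T Gamma x y * (pi x * P x y) =
  mass pi S * mass pi T * edge_prob Gamma x y.
Proof.
rewrite /congestion; case: (boolP (0 < P x y)) => Pxy.
  have : pi x * P x y != 0 by rewrite gt_eqF// mulr_gt0// stat_gt0.
  by move=> nz; rewrite mulrAC divfK.
by rewrite edge_prob_eq0// !mulr0 mul0r.
Qed.

Lemma avg_congestionE S T Gamma :
  avg_congestion S T Gamma =
  mass pi S * mass pi T * \sum_x \sum_y edge_prob Gamma x y.
Proof.
rewrite /avg_congestion mulr_sumr; apply: eq_bigr => x _.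
by rewrite mulr_sumr; apply: eq_bigr => y _; exact: congestion_mul_flow.
Qed.

Lemma sum_indic_fiber (f : Omega -> R) (h : chain_path M -> Omega) g :
  \sum_x f x * \1_[set g | h g = x] g = f (h g).
Proof.
rewrite (bigD1 (h g))//= indicE mem_set// mulr1 big1 ?addr0// => x xh.
by rewrite indicE memNset ?mulr0// => /= hx; rewrite hx eqxx in xh.
Qed.

Lemma cond_mean_flow_le S T Gamma (f : Omega -> R) :
  transport_flow S T Gamma ->
  cond_mean pi f S - cond_mean pi f T <=
    \sum_(e : Omega * Omega) edge_prob Gamma e.1 e.2 * `|f e.1 - f e.2|.
Proof.
move=> [GS GT].
(* The three sums are the expectations of [f] at the start, [f] at the end and
   of the variation of [f] along the distinct edges of the path. *)
pose c (i : Omega + Omega + Omega * Omega) : R :=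
  match i with
  | inl (inl x) => - f x | inl (inr x) => f x | inr e => `|f e.1 - f e.2|
  end.
pose A (i : Omega + Omega + Omega * Omega) : set (chain_path M) :=
  match i with
  | inl (inl x) => [set g | path_start g = x]
  | inl (inr x) => [set g | path_end g = x]
  | inr e => [set g | e \in path_edges g]
  end.
(* For each path the integrand is the variation over its distinct edges minus [f] at the start plus
   [f] at the end. *)
have : 0 <= \int[Gamma]_g (\sum_i c i * \1_(A i) g).
  apply: Rintegral_ge0 => g _; rewrite !big_sumType/=.
  under [X in X + _ + _]eq_bigr do rewrite mulNr.
  rewrite sumrN !sum_indic_fiber.
  rewrite [X in X + _]addrC -[X in X + _]opprB addrC subr_ge0.
  rewrite (le_trans (ler_norm _))//.
  rewrite (le_trans (dist_last_le_sum_edge_set _ _ _))//.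
  apply: ler_sum => e _; rewrite mulrC indicE.
  case: (boolP (e \in path_edges g)) => eg; first by rewrite mem_set.
  by rewrite memNset//; exact/negP.
rewrite Rintegral_sum_indic// !big_sumType/=.
(* The marginals of the flow identify the end-point terms with the conditional means. *)
have -> : cond_mean pi f S =
    \sum_x f x * fine (Gamma [set g | path_start g = x]).
  by apply: eq_bigr => x _; rewrite GS mulrC.
have -> : cond_mean pi f T =
    \sum_x f x * fine (Gamma [set g | path_end g = x]).
  by apply: eq_bigr => x _; rewrite GT mulrC.
under [X in X + _ + _]eq_bigr do rewrite mulNr.
under [X in _ -> _ <= X]eq_bigr => e _.
  rewrite edge_probE -surjective_pairing mulrC; over.
by rewrite sumrN /=; lra.
Qed.

(** The one-sided bound is applied to [f] and to its negative, which have the same variation. *)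
Lemma dist_cond_mean_flow_le S T Gamma (f : Omega -> R) :
  transport_flow S T Gamma ->
  `|cond_mean pi f S - cond_mean pi f T| <=
    \sum_(e : Omega * Omega) edge_prob Gamma e.1 e.2 * `|f e.1 - f e.2|.
Proof.
move=> flow; rewrite ler_norml lerNl opprB (cond_mean_flow_le _ flow) andbT.
have cmN B : cond_mean pi (\- f) B = - cond_mean pi f B.
  by rewrite -sumrN; apply: eq_bigr => x _; rewrite mulrN.
have := cond_mean_flow_le (\- f) flow.
rewrite !cmN opprK addrC => /le_trans; apply.
by apply: ler_sum => e _; rewrite -opprD normrN.
Qed.

End ErgodicChain.

Theorem theorem3p1 (R : realType) (Omega : finType)
    (M : ergodic_chain R Omega) (S T : {set Omega})
    (Gamma : probability (chain_path M) R) (rho : R) :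
  0 < mass (stat M) S -> 0 < mass (stat M) T ->
  transport_flow S T Gamma ->
  (forall x y, 0 < trans M x y -> congestion S T Gamma x y <= rho) ->
  avg_congestion S T Gamma =
    mass (stat M) S * mass (stat M) T * (\sum_x \sum_y edge_prob Gamma x y) /\
  forall f : Omega -> R,
    mass (stat M) S * mass (stat M) T *
      (cond_mean (stat M) f S - cond_mean (stat M) f T) ^+ 2 <=
    avg_congestion S T Gamma * rho / (mass (stat M) S * mass (stat M) T) *
      \sum_x \sum_y stat M x * trans M x y * (f x - f y) ^+ 2.
Proof.
move=> S0 T0 flow le_rho; split=> [|f]; first exact: avg_congestionE.
set m := mass _ S * mass _ T; have m0 : 0 < m by rewrite mulr_gt0.
set D := cond_mean _ f S - _.
rewrite avg_congestionE -/m !pair_bigA /=.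
set Q := \sum_e edge_prob Gamma _ _; set E := \sum_e _.
set L := \sum_(e : Omega * Omega) edge_prob Gamma e.1 e.2 * `|f e.1 - f e.2|.
set V := \sum_(e : Omega * Omega) edge_prob Gamma e.1 e.2 * `|f e.1 - f e.2| ^+ 2.
have DL : D ^+ 2 <= L ^+ 2.
  have DleL : `|D| <= L by exact: dist_cond_mean_flow_le.
  by rewrite -real_normK ?num_real// ler_sqr ?nnegrE// (le_trans _ DleL).
have LV : L ^+ 2 <= Q * V.
  by apply: sqr_weighted_sum_le => e; exact: edge_prob_ge0.
have VE : m * V <= rho * E.
  rewrite !mulr_sumr; apply: ler_sum => -[x y] _ /=.
  rewrite real_normK ?num_real// mulrA [leRHS]mulrA ler_wpM2r ?sqr_ge0//.
  rewrite -congestion_mul_flow; have pi0 := stat_gt0 M x.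
  (* The bound by [rho] is given only on edges of positive probability; on the others both sides are
     zero. *)
  have [->|Pxy] := eqVneq (trans M x y) 0; first by rewrite !mulr0.
  have {}Pxy : 0 < trans M x y.
    by rewrite lt_def Pxy /=; case: (trans_stochastic M x).
  by rewrite ler_wpM2r ?le_rho// mulr_ge0// ltW.
have Q0 : 0 <= Q by apply: sumr_ge0 => e _; exact: edge_prob_ge0.
(* One factor [m] of the average congestion cancels here; after [VE], the one on the left cancels
   against [m * V], leaving [D ^+ 2 <= Q * V]. *)
have -> : m * Q * rho / m * E = Q * (rho * E).
  by field; rewrite gt_eqF.
rewrite (le_trans _ (ler_wpM2l Q0 VE))// [leRHS]mulrCA ler_pM2l//.
exact: le_trans LV.
Qed.
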